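(* Let $h_1,h_2\in\mathbb{C}$, $q=e^{h_1}$, $p=e^{h_2}$, $pq\neq\pm1$, $h=\frac{h_1+h_2}{2}$. Let $T=\begin{pmatrix} a&\beta\\ \gamma&d\end{pmatrix}\in GL_{p,q}(1|1)$ and let $M=\begin{pmatrix} x&\mu\\ \nu&y\end{pmatrix}=\frac1h\ln T$ (so that $T=e^{hM}$). Then the matrix elements of $M$ satisfy $$[x,\mu]=\frac{2h_1}{h_1+h_2}\,\mu,\qquad [y,\mu]=\frac{2h_1}{h_1+h_2}\,\mu,\qquad \mu^2=0,$$ $$[x,\nu]=\frac{2h_2}{h_1+h_2}\,\nu,\qquad [y,\nu]=\frac{2h_2}{h_1+h_2}\,\nu,\qquad \nu^2=0,$$ $$xy-yx=0,\qquad \mu\nu+\nu\mu=0 .$$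
   Context: Setting: $a,\beta,\gamma,d$ are elements of a unital associative $\mathbb{C}$-algebra. The matrix $T=\begin{pmatrix} a&\beta\\ \gamma&d\end{pmatrix}$ is said to belong to $GL_{p,q}(1|1)$ if $a\beta=q\beta a$, $d\beta=q\beta d$, $a\gamma=p\gamma a$, $d\gamma=p\gamma d$, $\beta\gamma+pq^{-1}\gamma\beta=0$, $\beta^2=0=\gamma^2$, $ad-da=(p-q^{-1})\gamma\beta$; $a$ and $d$ are assumed invertible. $[u,v]=uv-vu$. The logarithm of $T$ is defined by the series $\ln T=\sum_{n\ge1}\frac{(-1)^{n+1}}{n}(T-I)^n$, assumed to make sense. Its entries are given by the following formulas, in which the logarithms of $a$ and $d$ are assumed to exist and the denominators to be non-zero, in which $\ln(q^{-1}d)=\ln d-h_1$, $\ln(p^{-1}a)=\ln a-h_2$, $\ln(p^{-1}q^{-1}u)=\ln u-h_1-h_2$ for $u=a,d$, and in which $a$ and $d$ behave as commuting quantities since they are multiplied by $\beta$ or $\gamma$: $$x=\tfrac1h\left\{\ln a+f_q(a,d,p)\beta\gamma\right\},\quad \mu=\tfrac1h\,\frac{\ln a-\ln(q^{-1}d)}{a-q^{-1}d}\,\beta,\quad y=\tfrac1h\left\{\ln d+f_p(d,a,q)\gamma\beta\right\},\quad \nu=\tfrac1h\,\frac{\ln d-\ln(p^{-1}a)}{d-p^{-1}a}\,\gamma,$$ $$f_q(a,d,p)\beta\gamma=\frac{q^2}{q-p^{-1}}\left(\frac{\ln a}{a(qa-d)}-\frac{\ln(p^{-1}q^{-1}a)}{a(p^{-1}a-d)}\right)\beta\gamma+q^2\frac{\ln(q^{-1}d)}{(p^{-1}a-d)(qa-d)}\beta\gamma,$$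 $$f_p(d,a,q)\gamma\beta=\frac{p^2}{p-q^{-1}}\left(\frac{\ln d}{d(pd-a)}-\frac{\ln(p^{-1}q^{-1}d)}{d(q^{-1}d-a)}\right)\gamma\beta+p^2\frac{\ln(p^{-1}a)}{(q^{-1}d-a)(pd-a)}\gamma\beta .$$ *)

(* Defs.v *)
From HB Require Import structures.
From mathcomp Require Import all_boot all_order all_algebra.
From mathcomp Require Export complex.
From mathcomp Require Import all_classical all_reals all_analysis.

Set Implicit Arguments.
Unset Strict Implicit.
Unset Printing Implicit Defensive.

Import Order.TTheory GRing.Theory Num.Theory.

Local Open Scope classical_set_scope.
Local Open Scope ring_scope.
Local Open Scope complex_scope.

HB.mixin Record hasContinuousMul (K : numDomainType) A
    & Topological A & GRing.UnitAlgebra K A := {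
  mul_continuous : continuous (fun z : A * A => z.1 * z.2)
}.

(* Unital associative algebras with a compatible topology, in which the
   logarithmic series can be summed.  The unit-ring structure only supplies
   a predicate for two-sided invertibility: classically every algebra has
   one.  Separation (hausdorff_space) is not included. *)
#[short(type="topologicalUnitAlgType")]
HB.structure Definition TopologicalUnitAlgebra (K : numDomainType) :=
  {A of TopologicalLmodule K A & GRing.UnitAlgebra K A
      & hasContinuousMul K A}.

Definition cexp (R : realType) (z : R[i]) : R[i] :=
  let: x +i* y := z in (expR x * cos y) +i* (expR x * sin y).

Section QuantumSupergroup.
Variables (K : numFieldType) (A : topologicalUnitAlgType K).
Implicit Types (p q : K) (a beta gamma d u l : A) (T L : 'M[A]_2).

Definition mx2 (a b c d : A) : 'M[A]_2 :=
  \matrix_(i < 2, j < 2)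
    if i == ord0 then (if j == ord0 then a else b)
    else (if j == ord0 then c else d).

Record GLpq11 p q a beta gamma d : Prop := {
  GLpq11_ab : a * beta = q *: (beta * a);
  GLpq11_db : d * beta = q *: (beta * d);
  GLpq11_ac : a * gamma = p *: (gamma * a);
  GLpq11_dc : d * gamma = p *: (gamma * d);
  GLpq11_bc : beta * gamma + (p / q) *: (gamma * beta) = 0;
  GLpq11_bb : beta ^+ 2 = 0;
  GLpq11_cc : gamma ^+ 2 = 0;
  GLpq11_ad : a * d - d * a = (p - q^-1) *: (gamma * beta);
  GLpq11_ua : a \is a GRing.unit;
  GLpq11_ud : d \is a GRing.unit }.

(* Index shifted by one: this multiplies the (n+1)-st power. *)
Definition ln_coeff (n : nat) : K := (-1) ^+ n / n.+1%:R.

Definition is_ln u l : Prop :=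
  series (fun n => ln_coeff n *: (u - 1) ^+ n.+1) @ \oo --> l.

Definition is_lnmx T L : Prop := forall i j : 'I_2,
  series (fun n => ln_coeff n *: ((T - 1) ^+ n.+1) i j) @ \oo --> L i j.

End QuantumSupergroup.

(* Main.v *)
(* Since beta^2 = gamma^2 = 0, the entries of (T - 1)^n, and hence of ln T, stay
   in closed sets cut out by skew-commutation with a and d and annihilation by
   beta and gamma.  Any z with z a = q^-1 a z satisfies
   z (p^-1 a) = (p^-1 q^-1 a) z, so that z ln a = (ln a - h1) z although
   ln (q^-1 a) itself need not exist; this gives the brackets of the diagonal
   entries with mu and nu.  Finally ln T commutes with T, which determines the
   entries of ln T up to the units q a - d, p d - a, a, d and reduces the
   remaining relations to identities between ln a, ln d, beta and gamma. *)
Require Import Defs.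
From mathcomp Require Import all_boot all_order all_algebra.
From mathcomp Require Import all_classical all_reals all_analysis.
From mathcomp Require Import ring.

Import Order.TTheory GRing.Theory Num.Theory.
Local Open Scope classical_set_scope.
Local Open Scope ring_scope.
Local Open Scope complex_scope.

Set Implicit Arguments.
Unset Strict Implicit.
Unset Printing Implicit Defensive.

(** * Termwise algebra with logarithmic series *)

Section LogSeries.
Variables (K : numFieldType) (A : topologicalUnitAlgType K).
Hypothesis hA : hausdorff_space A.
Implicit Types (x y : nat -> A) (l m s t u v z : A) (k c : K).

(** [x n] stands for an (n+1)-st power: [is_ln] and each entry of [is_lnmx] are instances by
    conversion. *)
Definition lnsum x l : Prop :=
  series (fun n => ln_coeff K n *: x n) @ \oo --> l.

Lemma lnsum_unique x l m : lnsum x l -> lnsum x m -> l = m.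
Proof. by move=> xl xm; exact: (cvg_unique hA xl xm). Qed.

Lemma eq_lnsum x y l : x =1 y -> lnsum x l -> lnsum y l.
Proof. by move=> /funext ->. Qed.

Lemma lnsumD x y l m :
  lnsum x l -> lnsum y m -> lnsum (fun n => x n + y n) (l + m).
Proof.
move=> xl ym; rewrite /lnsum.
have cD := continuous2_cvg (h := +%R) eventually_filter
  (add_continuous (l, m)) xl ym.
apply: cvg_trans cD.
apply: near_eq_cvg; apply: nearW => n.
by rewrite /series /= -big_split; apply: eq_bigr => i _; rewrite scalerDr.
Qed.

Lemma lnsumMl s x l : lnsum x l -> lnsum (fun n => s * x n) (s * l).
Proof.
move=> xl; rewrite /lnsum.
have cs : (fun=> s) @ \oo --> s by exact: cvg_cst.
have cM := continuous2_cvg (h := *%R) eventually_filter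
  (Defs.mul_continuous (s, l)) cs xl.
apply: cvg_trans cM.
apply: near_eq_cvg; apply: nearW => n.
by rewrite /series /= mulr_sumr; apply: eq_bigr => i _; rewrite scalerAr.
Qed.

Lemma lnsumMr s x l : lnsum x l -> lnsum (fun n => x n * s) (l * s).
Proof.
move=> xl; rewrite /lnsum.
have cs : (fun=> s) @ \oo --> s by exact: cvg_cst.
have cM := continuous2_cvg (h := *%R) eventually_filter
  (Defs.mul_continuous (l, s)) xl cs.
apply: cvg_trans cM.
apply: near_eq_cvg; apply: nearW => n.
by rewrite /series /= mulr_suml; apply: eq_bigr => i _; rewrite scalerAl.
Qed.

Lemma lnsumB x y l m :
  lnsum x l -> lnsum y m -> lnsum (fun n => x n - y n) (l - m).
Proof.
move=> xl /(lnsumMl (s := -1)) ym; have := lnsumD xl ym; rewrite mulN1r.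
by apply: eq_lnsum => n; rewrite mulN1r.
Qed.

Lemma lnsum_eq0 x l : (forall n, x n = 0) -> lnsum x l -> l = 0.
Proof.
move=> x0 /[dup] /(lnsumMl (s := 0)); rewrite mul0r => zl xl.
by apply: (lnsum_unique xl); apply: eq_lnsum zl => n; rewrite mul0r x0.
Qed.

Definition qcomm k z s : Prop := z * s = k *: (s * z).

(** Multiplication is continuous and limits are unique, so skew-commutation with a fixed [s] is a
    closed condition. *)
Lemma lnsum_qcomm k x l s :
  (forall n, qcomm k (x n) s) -> lnsum x l -> qcomm k l s.
Proof.
move=> xs xl; rewrite /qcomm scalerAl.
apply: (lnsum_unique (lnsumMr (s := s) xl)).
by apply: eq_lnsum (lnsumMl (s := k *: s) xl) => n; rewrite -scalerAl -xs.
Qed.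

Lemma lnsum_mull_eq0 s x l : (forall n, s * x n = 0) -> lnsum x l -> s * l = 0.
Proof. by move=> sx /(lnsumMl (s := s)); exact: lnsum_eq0. Qed.

Lemma lnsum_mulr_eq0 s x l : (forall n, x n * s = 0) -> lnsum x l -> l * s = 0.
Proof. by move=> sx /(lnsumMr (s := s)); exact: lnsum_eq0. Qed.

(** By induction [z] intertwines the powers of [u - 1] and [v - 1], hence the partial sums. The
    shift rules for logarithms come from this. *)
Lemma is_ln_intertwine u v l m z :
  z * u = v * z -> is_ln u l -> is_ln v m -> z * l = m * z.
Proof.
move=> zuv ul vm; apply: (lnsum_unique (lnsumMl (s := z) ul)).
apply: eq_lnsum (lnsumMr (s := z) vm) => n /=.
elim: n.+1 => [|k IH]; first by rewrite !expr0 mulr1 mul1r.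
have zuv1 : z * (u - 1) = (v - 1) * z by rewrite mulrBr mulrBl zuv mulr1 mul1r.
by rewrite !exprS mulrA zuv1 -!mulrA IH.
Qed.
End LogSeries.

(** * Weights under the quantum relations, and recursion for the powers of T - 1 *)

Section Entries.
Variables (K : numFieldType) (A : topologicalUnitAlgType K).
Implicit Types (a b c d f m s t z : A) (k p q r : K).

Lemma GLpq11_bcE p q a b c d :
  GLpq11 p q a b c d -> b * c = - (p / q) *: (c * b).
Proof.
by move=> [_ _ _ _ /eqP + _ _ _ _ _]; rewrite addr_eq0 scaleNr => /eqP.
Qed.

Lemma GLpq11_cbE p q a b c d : p != 0 -> q != 0 ->
  GLpq11 p q a b c d -> c * b = - (q / p) *: (b * c).
Proof.
move=> p0 q0 /GLpq11_bcE ->; rewrite scalerA mulrNN.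
by rewrite -mulrA mulKf // mulfV // scale1r.
Qed.

(** Exchanging a with d, beta with gamma and p with q is a symmetry of the relations; it carries
    results on the first row of a matrix over to the second. *)
Lemma GLpq11_swap p q a b c d : p != 0 -> q != 0 ->
  GLpq11 p q a b c d -> GLpq11 q p d c b a.
Proof.
move=> p0 q0 hT; have cbE := GLpq11_cbE p0 q0 hT.
case: hT => ab db ac dc bc bb cc ad ua ud; split => //.
  by rewrite cbE scaleNr addNr.
rewrite -opprB ad cbE scalerA -scaleNr; congr (_ *: _).
by rewrite mulrN opprK mulrBl mulrCA mulfV // mulr1 mulrA mulVf // mul1r.
Qed.

Lemma qcomm_inv k s z : k != 0 -> s * z = k *: (z * s) -> qcomm k^-1 z s.
Proof. by move=> k0 sz; rewrite /qcomm sz scalerA mulVf // scale1r. Qed.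

Lemma qcommD k z t s : qcomm k z s -> qcomm k t s -> qcomm k (z + t) s.
Proof. by rewrite /qcomm => zs ts; rewrite mulrDl mulrDr zs ts scalerDr. Qed.

Lemma qcommZ k j z s : qcomm k z s -> qcomm k (j *: z) s.
Proof.
by rewrite /qcomm => zs; rewrite -scalerAl zs -scalerAr scalerA mulrC -scalerA.
Qed.

Lemma qcomm0 k s : qcomm k 0 s.
Proof. by rewrite /qcomm mul0r mulr0 scaler0. Qed.

(* The closed conditions satisfied by every word in [a], [b], [c], [d] that
   contains one more [b] than [c]; those for [c] are [offdiag _ c b d a]. *)
Record offdiag k b c a d m : Prop := Offdiag {
  offdiag_a : qcomm k m a;
  offdiag_d : qcomm k m d;
  offdiag_bl : b * m = 0;
  offdiag_br : m * b = 0;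
  offdiag_cc : c * m * c = 0 }.

(* The same for words with equally many, and at least one, [b] and [c]. *)
Record balanced r b c a d f : Prop := Balanced {
  balanced_a : qcomm r f a;
  balanced_d : qcomm r f d;
  balanced_bl : b * f = 0;
  balanced_br : f * b = 0;
  balanced_cl : c * f = 0;
  balanced_cr : f * c = 0 }.

Lemma balanced_swap r b c a d f : balanced r b c a d f -> balanced r c b d a f.
Proof. by case. Qed.

Lemma offdiag0 k b c a d : offdiag k b c a d 0.
Proof. by split; rewrite ?mulr0 ?mul0r //; exact: qcomm0. Qed.

Lemma balanced0 k b c a d : balanced k b c a d 0.
Proof. by split; rewrite ?mulr0 ?mul0r //; exact: qcomm0. Qed.

Lemma offdiagD k b c a d m f :
  offdiag k b c a d m -> offdiag k b c a d f -> offdiag k b c a d (m + f).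
Proof.
case=> ? ? bm mb cmc [? ? bf fb cfc]; split; try exact: qcommD.
- by rewrite mulrDr bm bf addr0.
- by rewrite mulrDl mb fb addr0.
- by rewrite mulrDr mulrDl cmc cfc addr0.
Qed.

Lemma balancedD r b c a d m f :
  balanced r b c a d m -> balanced r b c a d f -> balanced r b c a d (m + f).
Proof.
case=> ? ? bm mb cm mc [? ? bf fb cf fc]; split; try exact: qcommD.
- by rewrite mulrDr bm bf addr0.
- by rewrite mulrDl mb fb addr0.
- by rewrite mulrDr cm cf addr0.
- by rewrite mulrDl mc fc addr0.
Qed.

Lemma offdiagZ k b c a d j m :
  offdiag k b c a d m -> offdiag k b c a d (j *: m).
Proof.
case=> ? ? bm mb cmc; split; try exact: qcommZ.
- by rewrite -scalerAr bm scaler0.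
- by rewrite -scalerAl mb scaler0.
- by rewrite -scalerAr -scalerAl cmc scaler0.
Qed.

Lemma balancedZ r b c a d j f :
  balanced r b c a d f -> balanced r b c a d (j *: f).
Proof.
case=> ? ? bm mb cm mc; split; try exact: qcommZ.
- by rewrite -scalerAr bm scaler0.
- by rewrite -scalerAl mb scaler0.
- by rewrite -scalerAr cm scaler0.
- by rewrite -scalerAl mc scaler0.
Qed.

Section Closure.
Variables (p q : K) (a b c d : A).
Hypotheses (p0 : p != 0) (q0 : q != 0) (hT : GLpq11 p q a b c d).

Lemma GLpq11_qba : qcomm q^-1 b a.
Proof. exact: (qcomm_inv q0 (GLpq11_ab hT)). Qed.
Lemma GLpq11_qbd : qcomm q^-1 b d.
Proof. exact: (qcomm_inv q0 (GLpq11_db hT)). Qed.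
Lemma GLpq11_qca : qcomm p^-1 c a.
Proof. exact: (qcomm_inv p0 (GLpq11_ac hT)). Qed.
Lemma GLpq11_qcd : qcomm p^-1 c d.
Proof. exact: (qcomm_inv p0 (GLpq11_dc hT)). Qed.

(** The commutator of [a] and [d] is a multiple of [c * b], which kills [m]. This is the precise
    sense in which [a] and [d] behave as commuting quantities. *)
Lemma ad_comm_kerb m : b * m = 0 -> a * d * m = d * a * m.
Proof.
move=> bm; apply/eqP; rewrite -subr_eq0 -mulrBl (GLpq11_ad hT).
by rewrite -scalerAl -mulrA bm mulr0 scaler0.
Qed.

Lemma qcomm_Ml k s m t : qcomm k m t -> s * t * m = t * s * m ->
  qcomm k (s * m) t.
Proof. by move=> mt stm; rewrite /qcomm -mulrA mt -scalerAr !mulrA stm. Qed.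

Lemma offdiag_mull_a m :
  offdiag q^-1 b c a d m -> offdiag q^-1 b c a d (a * m).
Proof.
case=> ma md bm mb cmc; split.
- exact: qcomm_Ml.
- exact: (qcomm_Ml md (ad_comm_kerb bm)).
- by rewrite mulrA GLpq11_qba -scalerAl -mulrA bm mulr0 scaler0.
- by rewrite -mulrA mb mulr0.
- rewrite mulrA GLpq11_qca -!scalerAl -!mulrA [c * (m * c)]mulrA cmc.
  by rewrite mulr0 scaler0.
Qed.

Lemma offdiag_mull_d m :
  offdiag q^-1 b c a d m -> offdiag q^-1 b c a d (d * m).
Proof.
case=> ma md bm mb cmc; split.
- exact: (qcomm_Ml ma (esym (ad_comm_kerb bm))).
- exact: qcomm_Ml.
- by rewrite mulrA GLpq11_qbd -scalerAl -mulrA bm mulr0 scaler0.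
- by rewrite -mulrA mb mulr0.
- rewrite mulrA GLpq11_qcd -!scalerAl -!mulrA [c * (m * c)]mulrA cmc.
  by rewrite mulr0 scaler0.
Qed.

Lemma balanced_mull_a r f :
  balanced r b c a d f -> balanced r b c a d (a * f).
Proof.
case=> fa fd bf fb cf fc; split.
- exact: qcomm_Ml.
- exact: (qcomm_Ml fd (ad_comm_kerb bf)).
- by rewrite mulrA GLpq11_qba -scalerAl -mulrA bf mulr0 scaler0.
- by rewrite -mulrA fb mulr0.
- by rewrite mulrA GLpq11_qca -scalerAl -mulrA cf mulr0 scaler0.
- by rewrite -mulrA fc mulr0.
Qed.

Lemma offdiag_b : offdiag q^-1 b c a d b.
Proof.
have bb : b * b = 0 by exact: GLpq11_bb hT.
have cc : c * c = 0 by exact: GLpq11_cc hT.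
split => //; [exact: GLpq11_qba|exact: GLpq11_qbd|].
by rewrite -mulrA (GLpq11_bcE hT) -scalerAr mulrA cc mul0r scaler0.
Qed.

Lemma offdiag_mulr_subd1 m : offdiag q^-1 b c a d m ->
  offdiag q^-1 b c a d (m * (d - 1)).
Proof.
move=> m_off; rewrite mulrBr mulr1 (offdiag_d m_off) -scaleN1r.
by apply: offdiagD; apply: offdiagZ => //; exact: offdiag_mull_d.
Qed.

Lemma offdiag_b_pow n : offdiag q^-1 b c a d (b * (d - 1) ^+ n).
Proof.
elim: n => [|n IH]; first by rewrite expr0 mulr1; exact: offdiag_b.
by rewrite exprSr mulrA; exact: offdiag_mulr_subd1.
Qed.

(** The weights q^-1 and p^-1 multiply. The field [offdiag_cc], which reads [b * m * b = 0] in the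
    swapped roles, is what kills [b * m] against [b] on the right. *)
Lemma balanced_mull_b m : offdiag p^-1 c b d a m ->
  balanced (p^-1 * q^-1) b c a d (b * m).
Proof.
have bb : b * b = 0 by exact: GLpq11_bb hT.
case=> md ma cm mc bmb; split.
- by rewrite /qcomm -mulrA ma -scalerAr !mulrA GLpq11_qba -scalerAl scalerA.
- by rewrite /qcomm -mulrA md -scalerAr !mulrA GLpq11_qbd -scalerAl scalerA.
- by rewrite mulrA bb mul0r.
- by [].
- by rewrite mulrA (GLpq11_cbE p0 q0 hT) -scalerAl -mulrA cm mulr0 scaler0.
- by rewrite -mulrA mc mulr0.
Qed.

(** Recursion for the upper right entry of (T - 1)^(n+1): [(d - 1) ^+ n + g] is the lower right
    entry of (T - 1)^n, and [b] absorbs its balanced part [g]. *)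
Lemma offdiag_step n m g : offdiag q^-1 b c a d m -> b * g = 0 ->
  offdiag q^-1 b c a d ((a - 1) * m + b * ((d - 1) ^+ n + g)).
Proof.
move=> m_off bg; rewrite mulrDr bg addr0 mulrBl mul1r -scaleN1r.
apply: offdiagD (offdiag_b_pow n); apply: offdiagD; first exact: offdiag_mull_a.
exact: offdiagZ.
Qed.

Lemma balanced_step f m :
  balanced (p^-1 * q^-1) b c a d f -> offdiag p^-1 c b d a m ->
  balanced (p^-1 * q^-1) b c a d ((a - 1) * f + b * m).
Proof.
move=> f_bal m_off; rewrite mulrBl mul1r -scaleN1r.
apply: balancedD (balanced_mull_b m_off); apply: balancedD.
  exact: balanced_mull_a.
exact: balancedZ.
Qed.
End Closure.

Lemma mx2M a b c d a' b' c' d' :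
  mx2 a b c d * mx2 a' b' c' d' =
  mx2 (a * a' + b * c') (a * b' + b * d') (c * a' + d * c') (c * b' + d * d').
Proof.
apply/matrixP => i j; rewrite !mxE big_ord_recl big_ord1 !mxE /=.
by case: (i == ord0); case: (j == ord0).
Qed.

Lemma mx2E (M : 'M[A]_2) : M = mx2 (M 0 0) (M 0 1) (M 1 0) (M 1 1).
Proof.
apply/matrixP => i j; rewrite !mxE.
by case: i j => [[|[|?]] ?] [[|[|?]] ?] //=; congr (M _ _); exact: val_inj.
Qed.

End Entries.

(** * Passage of the closed conditions to the sums of the series *)

Section Limits.
Variables (K : numFieldType) (A : topologicalUnitAlgType K).
Hypothesis hA : hausdorff_space A.
Implicit Types (a b c d f l m s t w z : A) (k p q r : K) (x : nat -> A).

Lemma lnsum_offdiag k b c a d x m :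
  (forall n, offdiag k b c a d (x n)) -> lnsum x m -> offdiag k b c a d m.
Proof.
move=> x_off xm; split.
- by apply: (lnsum_qcomm hA _ xm) => n; case: (x_off n).
- by apply: (lnsum_qcomm hA _ xm) => n; case: (x_off n).
- by apply: (lnsum_mull_eq0 hA _ xm) => n; case: (x_off n).
- by apply: (lnsum_mulr_eq0 hA _ xm) => n; case: (x_off n).
- have cx := lnsumMl (s := c) xm.
  by apply: (lnsum_mulr_eq0 hA _ cx) => n; case: (x_off n).
Qed.

Lemma lnsum_balanced r b c a d x f :
  (forall n, balanced r b c a d (x n)) -> lnsum x f -> balanced r b c a d f.
Proof.
move=> x_bal xf; split.
- by apply: (lnsum_qcomm hA _ xf) => n; case: (x_bal n).
- by apply: (lnsum_qcomm hA _ xf) => n; case: (x_bal n).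
- by apply: (lnsum_mull_eq0 hA _ xf) => n; case: (x_bal n).
- by apply: (lnsum_mulr_eq0 hA _ xf) => n; case: (x_bal n).
- by apply: (lnsum_mull_eq0 hA _ xf) => n; case: (x_bal n).
- by apply: (lnsum_mulr_eq0 hA _ xf) => n; case: (x_bal n).
Qed.

Lemma is_ln_comm s l : is_ln s l -> s * l = l * s.
Proof. by move=> sl; exact: (is_ln_intertwine hA _ sl sl). Qed.

(** [T] commutes with the powers of [T - 1]. Convergence is entrywise, so each entry of a product is
    treated as a sum of two multiplied series. *)
Lemma is_lnmx_comm (T L : 'M[A]_2) : is_lnmx T L -> T * L = L * T.
Proof.
move=> TL; apply/matrixP => i j; rewrite !mxE !big_ord_recl !big_ord0 !addr0.
have TLl := lnsumD (lnsumMl (s := T i ord0) (TL ord0 j))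
  (lnsumMl (s := T i (lift ord0 ord0)) (TL (lift ord0 ord0) j)).
have TLr := lnsumD (lnsumMr (s := T ord0 j) (TL i ord0))
  (lnsumMr (s := T (lift ord0 ord0) j) (TL i (lift ord0 ord0))).
apply: (lnsum_unique hA TLl); apply: eq_lnsum TLr => n.
have comm : (T - 1) ^+ n.+1 * T = T * (T - 1) ^+ n.+1.
  by apply/esym/commrX; rewrite /GRing.comm mulrBl mulrBr mulr1 mul1r.
by have /matrixP/(_ i j) := comm; rewrite !mxE !big_ord_recl !big_ord0 !addr0.
Qed.

(* The commutator of [ln s] with [w], when that of [s] with [w] is a weight
   vector for [s]: no commutation of [s] and [w] is needed. *)
Lemma is_ln_commutator r s l w : is_ln s l -> qcomm r (s * w - w * s) s ->
  qcomm r (l * w - w * l) s /\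
  s * (l * w - w * l) - (l * w - w * l) * s =
  l * (s * w - w * s) - (s * w - w * s) * l.
Proof.
move=> sl qE; split; last first.
  (* As [s] and [l] commute, the Jacobi identity gives [s, [l, w]] = [l, [s, w]]. *)
  have sls := is_ln_comm sl.
  rewrite !mulrBr !mulrBl !mulrA sls -!mulrA sls !opprB addrACA.
  by rewrite [RHS]addrACA; congr (_ + _); rewrite addrC.
have sE := lnsumB (lnsumMr (s := w) sl) (lnsumMl (s := w) sl).
apply: (lnsum_qcomm hA _ sE) => n /=.
elim: n.+1 => [|k IH]; first by rewrite expr0 mul1r mulr1 subrr; exact: qcomm0.
(* Leibniz rule for the commutator with [w]; each summand keeps the weight [r]. *)
have -> : (s - 1) ^+ k.+1 * w - w * (s - 1) ^+ k.+1 =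
    (s - 1) * ((s - 1) ^+ k * w - w * (s - 1) ^+ k)
    + (s * w - w * s) * (s - 1) ^+ k.
  have -> : s * w - w * s = (s - 1) * w - w * (s - 1).
    by rewrite mulrBl mulrBr mul1r mulr1 opprB addrA subrK.
  by move: (s - 1) => t; rewrite exprS mulrBr mulrBl !mulrA addrA subrK.
have ss : (s - 1) * s = s * (s - 1) by rewrite mulrBl mulrBr mul1r mulr1.
have sn : (s - 1) ^+ k * s = s * (s - 1) ^+ k.
  by apply/esym/commrX; rewrite /GRing.comm ss.
apply: qcommD; first by apply: (qcomm_Ml IH); rewrite ss.
by rewrite /qcomm -mulrA sn !mulrA qE -scalerAl.
Qed.
End Limits.

(** * Shape of the powers of T - 1 and of ln T *)

Section Powers.
Variables (K : numFieldType) (A : topologicalUnitAlgType K).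
Hypothesis hA : hausdorff_space A.
Variables (p q : K) (a b c d : A).
Hypotheses (p0 : p != 0) (q0 : q != 0) (hT : GLpq11 p q a b c d).
Local Notation T := (mx2 a b c d).

(** Induction by left multiplication with [T - 1]. On the diagonal, the words without [b] and [c]
    add up to the subtracted power, and the others are balanced. *)
Lemma mx2_pow n : let N := (T - 1) ^+ n in
  [/\ offdiag q^-1 b c a d (N 0 1), offdiag p^-1 c b d a (N 1 0),
      balanced (p^-1 * q^-1) b c a d (N 0 0 - (a - 1) ^+ n)
    & balanced (p^-1 * q^-1) b c a d (N 1 1 - (d - 1) ^+ n)].
Proof.
have hT' := GLpq11_swap p0 q0 hT.
have TB1 : T - 1 = mx2 (a - 1) b c (d - 1).
  by rewrite [T - 1]mx2E !mxE /= !subr0.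
elim: n => [|n]; rewrite /=.
  rewrite !expr0 !mxE /= !subrr.
  by split; [exact: offdiag0|exact: offdiag0|exact: balanced0|exact: balanced0].
rewrite !exprS; set N := (T - 1) ^+ n.
set f := N 0 0 - _; set g := N 1 1 - _; case=> o01 o10 bf bg.
have -> : (T - 1) * N = mx2 ((a - 1) * N 0 0 + b * N 1 0)
    ((a - 1) * N 0 1 + b * N 1 1) (c * N 0 0 + (d - 1) * N 1 0)
    (c * N 0 1 + (d - 1) * N 1 1).
  by rewrite TB1 {1}[N]mx2E mx2M.
have fE : N 0 0 = (a - 1) ^+ n + f by rewrite addrC subrK.
have gE : N 1 1 = (d - 1) ^+ n + g by rewrite addrC subrK.
rewrite !mxE /=; split.
- by rewrite gE; apply: (offdiag_step p0 q0 hT) => //; case: bg.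
- by rewrite addrC fE; apply: (offdiag_step q0 p0 hT') => //; case: bf.
- by rewrite addrAC -mulrBr; exact: (balanced_step p0 q0 hT).
(* The swapped quadruple yields the weight with its factors in the other order, whence the two uses
   of [mulrC]. *)
- rewrite -addrA -mulrBr addrC; apply: balanced_swap.
  rewrite mulrC; apply: (balanced_step q0 p0 hT' _ o01).
  by rewrite mulrC; case: bg.
Qed.

Lemma lnmx_entries (lna lnd : A) (L : 'M[A]_2) :
  is_ln a lna -> is_ln d lnd -> is_lnmx T L ->
  [/\ offdiag q^-1 b c a d (L 0 1), offdiag p^-1 c b d a (L 1 0),
      balanced (p^-1 * q^-1) b c a d (L 0 0 - lna)
    & balanced (p^-1 * q^-1) b c a d (L 1 1 - lnd)].
Proof.
move=> hlna hlnd TL; split.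
- by apply: (lnsum_offdiag hA _ (TL 0 1)) => n; case: (mx2_pow n.+1).
- by apply: (lnsum_offdiag hA _ (TL 1 0)) => n; case: (mx2_pow n.+1).
- by apply: (lnsum_balanced hA _ (lnsumB (TL 0 0) hlna)) => n;
    case: (mx2_pow n.+1).
- by apply: (lnsum_balanced hA _ (lnsumB (TL 1 1) hlnd)) => n;
    case: (mx2_pow n.+1).
Qed.
End Powers.

(** * Commutator identities for perturbed logarithms *)

Lemma addr_swap (V : zmodType) (x y z t : V) : x + y = z + t -> x - t = z - y.
Proof. by move=> E; rewrite -[x](addrK y) E addrAC addrK. Qed.

Section Commutators.
Variables (K : nzRingType) (A : lalgType K).
Implicit Types (f g l m z : A) (k : K).

Lemma ad_weight l f z k : z * f = 0 /\ f * z = 0 -> z * l = l * z - k *: z ->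
  (l + f) * z - z * (l + f) = k *: z.
Proof.
move=> [zf fz] zl.
by rewrite mulrDl mulrDr zf fz !addr0 zl opprB addrC subrK.
Qed.

(** The cross terms [l, g] and [f, m] contribute k g and -k f; [l] and [m] need not commute. *)
Lemma commutatorD k l m f g : f * g = 0 -> g * f = 0 ->
  g * l = l * g - k *: g -> f * m = m * f - k *: f ->
  (l + f) * (m + g) - (m + g) * (l + f) = k *: (g - f) - (m * l - l * m).
Proof.
move=> fg gf gl fm; rewrite !mulrDl !mulrDr fg gf !addr0 gl fm.
rewrite [m * f - _]addrC addrACA [l * g - _]addrC [X in _ - X]addrACA.
rewrite [m * f + _]addrC [_ - k *: g + _]addrC addrKA scalerBr !opprB.
by rewrite [LHS]addrC addrACA [RHS]addrACA [- _ - _]addrC.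
Qed.
End Commutators.

(** * The off-diagonal entries of ln T *)

Section OffDiagonal.
Variables (K : numFieldType) (A : topologicalUnitAlgType K).
Variables (p q h1 h2 : K) (a b c d lna lnd M : A).
Hypotheses (p0 : p != 0) (q0 : q != 0) (hT : GLpq11 p q a b c d).
Hypothesis M_off : offdiag q^-1 b c a d M.
Local Notation U := (q *: a - d).
Local Notation w := (lna - lnd + h1%:A).

(** [w] is ln a - ln (q^-1 d) and [U] is q (a - q^-1 d), so the conclusion is the quotient formula
    for the upper right entry, cleared of its denominator. The weight of [M] turns q (a M - M d)
    into [U * M]. *)
Lemma offdiag_lnE f g :
  (forall z, qcomm q^-1 z d -> z * lnd = lnd * z - h1 *: z) ->
  f * b = 0 -> b * g = 0 ->
  a * M + b * (lnd + g) = (lna + f) * b + M * d -> U * M = q *: (w * b).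
Proof.
move=> q_lnd fb bg; rewrite mulrDr mulrDl bg fb !addr0 => /addr_swap aM.
have -> : U * M = q *: (a * M - M * d).
  rewrite mulrBl -scalerAl scalerBr (offdiag_d M_off) scalerA mulfV //.
  by rewrite scale1r.
rewrite aM (q_lnd _ (GLpq11_qbd q0 hT)) opprB addrCA addrC -addrA.
by rewrite !mulrDl mulNr -scalerAl mul1r addrA addrAC.
Qed.

Lemma qcomm_U k z : qcomm k z a -> qcomm k z d -> qcomm k z U.
Proof.
rewrite /qcomm => za zd; rewrite mulrBr mulrBl scalerBr zd -scalerAr za.
by rewrite -scalerAl !scalerA mulrC.
Qed.

Lemma comm_w k z : z * lna = lna * z - k *: z ->
  z * lnd = lnd * z - k *: z -> z * w = w * z.
Proof.
move=> za zd; rewrite mulrDr mulrDl mulrBr mulrBl za zd.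
by rewrite opprB addrA subrK -scalerAr mulr1 -scalerAl mul1r.
Qed.

Hypotheses (hU : U \is a GRing.unit) (UM : U * M = q *: (w * b)).

Lemma offdiag_sqr : M * M = 0.
Proof.
apply: (mulrI hU); rewrite mulrA UM mulr0 -scalerAl -mulrA.
by rewrite (offdiag_bl M_off) mulr0 scaler0.
Qed.

(** [U] turns [M] into a multiple of [w * b]. Moving [f] past [U] costs a scalar, past [w] nothing,
    and [f] meets [b]. *)
Lemma offdiag_balanced r k f : r != 0 -> balanced r b c a d f ->
  f * lna = lna * f - k *: f -> f * lnd = lnd * f - k *: f ->
  M * f = 0 /\ f * M = 0.
Proof.
move=> r0 [fa fd bf fb _ _] f_lna f_lnd.
split; apply: (mulrI hU); rewrite mulr0 mulrA.
  by rewrite UM -scalerAl -mulrA bf mulr0 scaler0.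
apply/(scalerI r0); rewrite scaler0 scalerAl -(qcomm_U fa fd) -mulrA UM.
by rewrite -scalerAr mulrA (comm_w f_lna f_lnd) -mulrA fb mulr0 scaler0.
Qed.

(** Moving [c] past [U] costs p, past [w] nothing and past [b] the factor -q/p: in total -q. *)
Lemma c_offdiag : c * lna = lna * c - h2 *: c ->
  c * lnd = lnd * c - h2 *: c -> c * M = - (q *: (M * c)).
Proof.
move=> c_lna c_lnd; apply: (mulrI hU); rewrite mulrN -scalerAr !mulrA.
have -> : U * c = p *: (c * U).
  rewrite (qcomm_U (GLpq11_qca p0 hT) (GLpq11_qcd p0 hT)) scalerA mulfV //.
  by rewrite scale1r.
rewrite -scalerAl -[c * U * M]mulrA UM -scalerAr -scalerAl mulrA.
rewrite (comm_w c_lna c_lnd) -!mulrA (GLpq11_cbE p0 q0 hT) -scalerAr.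
rewrite !scalerA -scaleNr; congr (_ *: _).
by field.
Qed.
End OffDiagonal.

(* Comparing [ln (j s)] and [ln (j k s)] rather than [ln s] and [ln (k s)]
   matters: [ln (q^-1 a)] and [ln (p^-1 d)] are not assumed to exist. *)
Lemma is_ln_weight (K : numFieldType) (A : topologicalUnitAlgType K)
    (hA : hausdorff_space A) (k j e h : K) (s l z : A) :
  is_ln (j *: s) (l - e%:A) -> is_ln ((j * k) *: s) (l - e%:A - h%:A) ->
  qcomm k z s -> z * l = l * z - h *: z.
Proof.
move=> sl ksl zs.
have : z * (j *: s) = (j * k) *: s * z.
  by rewrite -scalerAr zs scalerA -scalerAl.
move/(is_ln_intertwine hA)/(_ sl ksl).
rewrite mulrBr !mulrBl -scalerAr -!scalerAl mulr1 !mul1r addrAC.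
by move/addIr.
Qed.

(** * The relations between the entries of ln T *)

Section Main.
Variables (K : numFieldType) (A : topologicalUnitAlgType K).
Hypothesis hA : hausdorff_space A.
Variables (p q h1 h2 : K) (a b c d lna lnd : A).
Hypotheses (p0 : p != 0) (q0 : q != 0) (pq1 : p * q != 1).
Hypothesis hT : GLpq11 p q a b c d.
Hypotheses (hU : q *: a - d \is a GRing.unit)
  (hV : p *: d - a \is a GRing.unit).
Hypotheses (hlna : is_ln a lna) (hlnd : is_ln d lnd)
  (hlnqd : is_ln (q^-1 *: d) (lnd - h1%:A))
  (hlnpa : is_ln (p^-1 *: a) (lna - h2%:A))
  (hlnpqa : is_ln ((p^-1 * q^-1) *: a) (lna - h1%:A - h2%:A))
  (hlnpqd : is_ln ((p^-1 * q^-1) *: d) (lnd - h1%:A - h2%:A)).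
Variable L : 'M[A]_2.
Hypothesis hL : is_lnmx (mx2 a b c d) L.
Implicit Types (s l z f : A).
Local Notation r := (p^-1 * q^-1).
Local Notation H := (h1 + h2).
Local Notation F := (L 0 0 - lna).
Local Notation G := (L 1 1 - lnd).
Local Notation M := (L 0 1).
Local Notation N := (L 1 0).
Local Notation U := (q *: a - d).
Local Notation V := (p *: d - a).
Local Notation w := (lna - lnd + h1%:A).
Local Notation w' := (lnd - lna + h2%:A).

Let ln1 s l : is_ln s l -> is_ln (1 *: s) (l - 0%:A).
Proof. by rewrite scale1r scale0r subr0. Qed.

Lemma q_lna z : qcomm q^-1 z a -> z * lna = lna * z - h1 *: z.
Proof. by apply: is_ln_weight hlnpa _ => //; rewrite addrAC. Qed.

Lemma q_lnd z : qcomm q^-1 z d -> z * lnd = lnd * z - h1 *: z.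
Proof.
by apply: is_ln_weight (ln1 hlnd) _ => //; rewrite scale0r subr0 mul1r.
Qed.

Lemma p_lna z : qcomm p^-1 z a -> z * lna = lna * z - h2 *: z.
Proof.
by apply: is_ln_weight (ln1 hlna) _ => //; rewrite scale0r subr0 mul1r.
Qed.

Lemma p_lnd z : qcomm p^-1 z d -> z * lnd = lnd * z - h2 *: z.
Proof. by apply: is_ln_weight hlnqd _ => //; rewrite [q^-1 * _]mulrC. Qed.

Lemma r_lna z : qcomm r z a -> z * lna = lna * z - H *: z.
Proof.
apply: is_ln_weight (ln1 hlna) _ => //.
by rewrite scale0r subr0 mul1r scalerDl opprD addrA.
Qed.

Lemma r_lnd z : qcomm r z d -> z * lnd = lnd * z - H *: z.
Proof.
apply: is_ln_weight (ln1 hlnd) _ => //.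
by rewrite scale0r subr0 mul1r scalerDl opprD addrA.
Qed.

Let hT' : GLpq11 q p d c b a := GLpq11_swap p0 q0 hT.
Let r0 : r != 0. Proof. by rewrite mulf_neq0 ?invr_eq0. Qed.
(** If z s = r s z then s z - z s = (1 - r) s z; p q != 1 allows this factor to be cancelled. *)
Let r1 : 1 - r != 0.
Proof. by rewrite subr_eq0 eq_sym -invfM invr_eq1. Qed.

Lemma comm_entries :
  [/\ a * L 0 0 + b * N = L 0 0 * a + M * c,
      a * M + b * L 1 1 = L 0 0 * b + M * d,
      c * L 0 0 + d * N = N * a + L 1 1 * c
    & c * M + d * L 1 1 = N * b + L 1 1 * d].
Proof.
have := is_lnmx_comm hA hL; rewrite [L]mx2E !mx2M => /matrixP E.
have := E 0 0; have := E 0 1; have := E 1 0; have := E 1 1.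
by rewrite !mxE.
Qed.

Let entries := lnmx_entries hA p0 q0 hT hlna hlnd hL.
Let M_off : offdiag q^-1 b c a d M. Proof. by case: entries. Qed.
Let N_off : offdiag p^-1 c b d a N. Proof. by case: entries. Qed.
Let F_bal : balanced r b c a d F. Proof. by case: entries. Qed.
Let G_bal : balanced r b c a d G. Proof. by case: entries. Qed.
Let comm12 : a * M + b * (lnd + G) = (lna + F) * b + M * d.
Proof. by rewrite ![_ + (_ - _)]addrC !subrK; case: comm_entries. Qed.
Let comm21 : d * N + c * (lna + F) = (lnd + G) * c + N * a.
Proof.
by rewrite ![_ + (_ - _)]addrC !subrK addrC [RHS]addrC; case: comm_entries.
Qed.

Let UM : U * M = q *: (w * b).
Proof.
by apply: (offdiag_lnE q0 hT M_off q_lnd _ _ comm12); [case: F_bal|case: G_bal].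
Qed.

Let VN : V * N = p *: (w' * c).
Proof.
by apply: (offdiag_lnE p0 hT' N_off p_lna _ _ comm21);
  [case: G_bal|case: F_bal].
Qed.

Let c_lna : c * lna = lna * c - h2 *: c.
Proof. exact: p_lna (GLpq11_qca p0 hT). Qed.
Let c_lnd : c * lnd = lnd * c - h2 *: c.
Proof. exact: p_lnd (GLpq11_qcd p0 hT). Qed.

Let cM : c * M = - (q *: (M * c)).
Proof. exact: (c_offdiag p0 q0 hT hU UM c_lna c_lnd). Qed.

Let bN : b * N = - (p *: (N * b)).
Proof.
have b_lna := q_lna (GLpq11_qba q0 hT); have b_lnd := q_lnd (GLpq11_qbd q0 hT).
exact: (c_offdiag q0 p0 hT' hV VN b_lnd b_lna).
Qed.

Let M_balanced f : balanced r b c a d f -> M * f = 0 /\ f * M = 0.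
Proof.
move=> f_bal; have [fa fd _ _ _ _] := f_bal.
exact: (offdiag_balanced hU UM r0 f_bal (r_lna fa) (r_lnd fd)).
Qed.

Let N_balanced f : balanced r b c a d f -> N * f = 0 /\ f * N = 0.
Proof.
move=> f_bal; have [fa fd _ _ _ _] := f_bal.
have f_bal' := balanced_swap f_bal.
exact: (offdiag_balanced hV VN r0 f_bal' (r_lnd fd) (r_lna fa)).
Qed.

(** The balanced part of a diagonal entry annihilates [M] and [N] on both sides, so only the shift
    rules for [lna] and [lnd] contribute. *)
Lemma lnmx_weights :
  [/\ L 0 0 * M - M * L 0 0 = h1 *: M, L 1 1 * M - M * L 1 1 = h1 *: M,
      L 0 0 * N - N * L 0 0 = h2 *: N & L 1 1 * N - N * L 1 1 = h2 *: N].
Proof.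
have XE : L 0 0 = lna + F by rewrite addrC subrK.
have YE : L 1 1 = lnd + G by rewrite addrC subrK.
have [Ma Md _ _ _] := M_off; have [Nd Na _ _ _] := N_off.
rewrite XE YE; split; apply: ad_weight.
- exact: M_balanced.
- exact: q_lna.
- exact: M_balanced.
- exact: q_lnd.
- exact: N_balanced.
- exact: p_lna.
- exact: N_balanced.
- exact: p_lnd.
Qed.

Lemma lnmx_sqr : M * M = 0 /\ N * N = 0.
Proof.
split; [exact: offdiag_sqr M_off hU UM|exact: offdiag_sqr N_off hV VN].
Qed.

(** U V - V U = (p q - 1)(a d - d a). *)
Lemma UV_comm_kerb z : b * z = 0 -> U * V * z = V * U * z.
Proof.
move=> bz; have adz := ad_comm_kerb hT bz.
rewrite -!mulrA ![V * _]mulrBl ![U * _]mulrBl -!scalerAl !mulrBr -!scalerAr.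
rewrite !mulrA -adz !scalerBr !scalerA [p * q]mulrC !opprB !addrA.
by rewrite addrAC [RHS]addrAC; congr (_ + _); rewrite addrAC.
Qed.

Let wDw' : w + w' = H%:A.
Proof. by rewrite addrACA -opprB addNr add0r scalerDl. Qed.

(** The sum of [w] and [w'] is a scalar, so they commute even if [lna] and [lnd] do not. *)
Let ww' : w * w' = w' * w.
Proof.
have -> : w' = H%:A - w by rewrite -wDw' [RHS]addrC addKr.
by rewrite mulrBr mulrBl -scalerAl -scalerAr mul1r mulr1.
Qed.

(** Multiplied by [U * V], both products become multiples of w w' b c, with opposite coefficients
    q^2 p and -p q^2. *)
Lemma lnmx_anticomm : M * N + N * M = 0.
Proof.
have [Ma Md bM _ _] := M_off; have [Nd Na _ _ _] := N_off.
have VM : V * M = q *: (M * V).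
  by rewrite (qcomm_U p Md Ma) scalerA mulfV // scale1r.
have UN : U * N = p *: (N * U).
  by rewrite (qcomm_U q Na Nd) scalerA mulfV // scale1r.
have bw' : b * w' = w' * b.
  exact: (comm_w h2 (q_lnd (GLpq11_qbd q0 hT)) (q_lna (GLpq11_qba q0 hT))).
have cw : c * w = w * c by exact: (comm_w h1 c_lna c_lnd).
have bNM : b * (N * M) = 0.
  by rewrite mulrA bN mulNr -scalerAl -mulrA bM mulr0 scaler0 oppr0.
apply: (mulrI hV); apply: (mulrI hU); rewrite !mulr0 mulrA mulrDr.
rewrite (UV_comm_kerb bNM).
have -> : U * V * (M * N) = (q * q * p) *: (w * w' * (b * c)).
  rewrite [LHS]mulrA -[U * V * M]mulrA VM -scalerAr [U * _]mulrA UM -!scalerAl.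
  rewrite -[w * b * V * N]mulrA VN -scalerAr !scalerA !mulrA.
  by rewrite -[w * b * w']mulrA bw' !mulrA.
have -> : V * U * (N * M) = (p * p * q) *: (w' * w * (c * b)).
  rewrite [LHS]mulrA -[V * U * N]mulrA UN -scalerAr [V * _]mulrA VN -!scalerAl.
  rewrite -[w' * c * U * M]mulrA UM -scalerAr !scalerA !mulrA.
  by rewrite -[w' * c * w]mulrA cw !mulrA.
rewrite ww' (GLpq11_cbE p0 q0 hT) -scalerAr scalerA -scalerDl.
apply/eqP; rewrite scaler_eq0; apply/orP; left; apply/eqP; by field.
Qed.

Let cb_bal : balanced r b c a d (c * b).
Proof.
rewrite mulrC; apply: balanced_swap.
exact: (balanced_mull_b q0 p0 hT' (offdiag_b q0 hT)).
Qed.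

(** The upper left entry of T L = L T gives a F - F a, and [F] has weight [r]. *)
Lemma F_lnE : (1 - r) *: (a * F) = M * c + p *: (N * b).
Proof.
have [Fa _ _ _ _ _] := F_bal; have [+ _ _ _] := comm_entries.
have XE : L 0 0 = lna + F by rewrite addrC subrK.
rewrite {1 2}XE mulrDr mulrDl (is_ln_comm hA hlna) -!addrA => /addrI.
by rewrite [_ + M * c]addrC => /addr_swap; rewrite Fa bN opprK scalerBl scale1r.
Qed.

Lemma G_lnE : (1 - r) *: (d * G) = N * b + q *: (M * c).
Proof.
have [_ Gd _ _ _ _] := G_bal; have [_ _ _ +] := comm_entries.
have YE : L 1 1 = lnd + G by rewrite addrC subrK.
rewrite {1 2}YE mulrDr mulrDl (is_ln_comm hA hlnd) [c * M + _]addrC.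
rewrite [N * b + _]addrC -!addrA => /addrI.
by rewrite [_ + N * b]addrC => /addr_swap; rewrite Gd cM opprK scalerBl scale1r.
Qed.

(** The two diagonal formulas combine into U M c - V N b, where [w] and [w'] add up to the scalar
    [H]. *)
Lemma adGF : (1 - r) *: (a * d * (G - F)) = - (p * H) *: (c * b).
Proof.
have bF : b * F = 0 by case: F_bal.
rewrite mulrBr (ad_comm_kerb hT bF) -!mulrA scalerBr.
rewrite [_ *: (a * _)]scalerAr G_lnE [_ *: (d * _)]scalerAr F_lnE.
have -> : a * (N * b + q *: (M * c)) - d * (M * c + p *: (N * b))
    = U * M * c - V * N * b.
  rewrite !mulrDr !mulrBl -!scalerAl -!scalerAr !mulrA opprD opprB.
  by rewrite [X in X + _]addrC addrACA.
rewrite UM VN -!scalerAl -!mulrA (GLpq11_bcE hT) -scalerAr scalerA mulrN.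
rewrite [q * _]mulrC mulfVK // scaleNr -opprD -scalerDr -mulrDl wDw'.
by rewrite -scalerAl mul1r scalerA scaleNr.
Qed.

Let ua : a \is a GRing.unit. Proof. by case: hT. Qed.
Let ud : d \is a GRing.unit. Proof. by case: hT. Qed.

(** [is_ln_commutator] is used twice: from [a, d] to E = [ln a, d], then from E to [ln d, ln a].
    Each use brings a factor [H] and a division by [1 - r]; one of these divisions is absorbed by p
    - q^-1 = p (1 - r). *)
Lemma lna_lnd_comm :
  (1 - r) *: (a * d * (lnd * lna - lna * lnd)) = - (p * (H * H)) *: (c * b).
Proof.
have [cb_a cb_d b_cb _ _ _] := cb_bal.
have adE := GLpq11_ad hT.
have [|Ea] := is_ln_commutator hA (r := r) (w := d) hlna.
  by rewrite adE; exact: qcommZ.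
set E := lna * d - d * lna in Ea *; set k := p - q^-1 in adE.
rewrite adE -scalerAr -scalerAl -scalerBr (r_lna cb_a) opprB addrCA subrr addr0.
rewrite Ea scalerA => aE.
have {}aE : (1 - r) *: (a * E) = (k * H) *: (c * b).
  by rewrite scalerBl scale1r -aE.
(* This lets [a] and [d] commute in front of [E], so that [E] gets weight [r] for [d] too. *)
have bE : b * E = 0.
  have : b * (a * E) = 0.
    by apply: (scalerI r1); rewrite scaler0 scalerAr aE -scalerAr b_cb scaler0.
  rewrite mulrA (GLpq11_qba q0 hT) -scalerAl -mulrA => /eqP.
  rewrite scaler_eq0 invr_eq0 (negPf q0) => /eqP abE.
  by apply: (mulrI ua); rewrite abE mulr0.
have Ed : qcomm r E d.
  apply: (mulrI ua); apply: (scalerI r1).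
  rewrite mulrA scalerAl aE -scalerAl cb_d -scalerAr [a * _]mulrA.
  rewrite (ad_comm_kerb hT bE) -[d * a * E]mulrA [RHS]scalerA.
  rewrite [(1 - r) * _]mulrC -[RHS]scalerA [(1 - r) *: _]scalerAr aE -scalerAr.
  by rewrite !scalerA [X in X *: _]mulrC.
have [|qE'] := is_ln_commutator hA (r := r) (w := lna) hlnd.
  by rewrite -opprB -scaleN1r; exact: qcommZ.
rewrite qE' -[d * lna - _]opprB mulrN mulNr opprK (r_lnd Ed) addKr.
set E' := lnd * lna - _ => dE'.
apply: (scalerI r1); rewrite -mulrA [_ *: (a * _)]scalerAr.
have -> : (1 - r) *: (d * E') = - (H *: E) by rewrite scalerBl scale1r dE'.
rewrite mulrN -scalerAr scalerN scalerA mulrC -scalerA aE !scalerA -scaleNr.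
congr (_ *: _); rewrite /k; field.
by rewrite p0 q0.
Qed.

(** The cross terms H (G - F) and the commutator of the logarithms cancel: multiplied by (1 - r) a
    d, both equal -p H^2 c b. *)
Lemma lnmx_comm_diag : L 0 0 * L 1 1 - L 1 1 * L 0 0 = 0.
Proof.
have XE : L 0 0 = lna + F by rewrite addrC subrK.
have YE : L 1 1 = lnd + G by rewrite addrC subrK.
have [_ Fd bF _ cF _] := F_bal; have [Ga _ bG _ cG _] := G_bal.
have FG : F * G = 0.
  apply: (mulrI ua); apply: (scalerI r1); rewrite mulrA scalerAl F_lnE mulrDl.
  by rewrite -scalerAl -!mulrA cG bG !mulr0 !scaler0 addr0.
have GF : G * F = 0.
  apply: (mulrI ud); apply: (scalerI r1); rewrite mulrA scalerAl G_lnE mulrDl.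
  by rewrite -scalerAl -!mulrA cF bF !mulr0 !scaler0 addr0.
have -> : L 0 0 * L 1 1 - L 1 1 * L 0 0 =
    H *: (G - F) - (lnd * lna - lna * lnd).
  rewrite {1 2}XE {1 2}YE.
  by rewrite (commutatorD FG GF (r_lna Ga) (r_lnd Fd)).
apply: (mulrI ud); apply: (mulrI ua); apply: (scalerI r1).
rewrite !mulr0 scaler0 [a * _]mulrA mulrBr scalerBr lna_lnd_comm -scalerAr.
rewrite scalerA mulrC -scalerA adGF scalerA -scalerBl.
by apply/eqP; rewrite scaler_eq0; apply/orP; left; apply/eqP; ring.
Qed.
End Main.

(** * Parameters as exponentials, and rescaling by 1/h *)

Lemma cexp_mulN (R : realType) (z : R[i]) : cexp z * cexp (- z) = 1.
Proof.
case: z => x y; rewrite /cexp /= cosN sinN.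
have ee : expR x * expR (- x) = 1 by rewrite -expRD subrr expR0.
have cs := cos2Dsin2 y.
apply/eqP; rewrite eq_complex /=; apply/andP; split; apply/eqP; last by ring.
rewrite -[RHS]mulr1 -{1}ee -cs; ring.
Qed.

Unset Implicit Arguments.

Theorem proposition4p2 (R : realType) (A : topologicalUnitAlgType R[i])
    (hA : hausdorff_space A)
    (h1 h2 p q h : R[i])
    (hq : q = cexp h1) (hp : p = cexp h2)
    (hpq1 : p * q != 1) (hpqN1 : p * q != -1)
    (hh : h = (h1 + h2) / 2)
    (a beta gamma d : A)
    (hT : GLpq11 p q a beta gamma d)
    (* The denominators in the entries of ln T are invertible; the remaining
       ones are scalar multiples of these, of a and of d. *)
    (hqad : q *: a - d \is a GRing.unit)
    (hpda : p *: d - a \is a GRing.unit)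
    (* The logarithms of a, d and of their rescalings exist, with
       ln (q^-1 d) = ln d - h1, and so on. *)
    (lna lnd : A)
    (hlna : is_ln a lna) (hlnd : is_ln d lnd)
    (hlnqd : is_ln (q^-1 *: d) (lnd - h1%:A))
    (hlnpa : is_ln (p^-1 *: a) (lna - h2%:A))
    (hlnpqa : is_ln ((p^-1 * q^-1) *: a) (lna - h1%:A - h2%:A))
    (hlnpqd : is_ln ((p^-1 * q^-1) *: d) (lnd - h1%:A - h2%:A))
    (lnT : 'M[A]_2) (hlnT : is_lnmx (mx2 a beta gamma d) lnT)
    (x mu nu y : A)
    (hM : mx2 x mu nu y = map_mx (fun u : A => h^-1 *: u) lnT) :
  [/\ x * mu - mu * x = (2 * h1 / (h1 + h2)) *: mu,
      y * mu - mu * y = (2 * h1 / (h1 + h2)) *: mu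
    & mu ^+ 2 = 0] /\
  [/\ x * nu - nu * x = (2 * h2 / (h1 + h2)) *: nu,
      y * nu - nu * y = (2 * h2 / (h1 + h2)) *: nu
    & nu ^+ 2 = 0] /\
  x * y - y * x = 0 /\
  mu * nu + nu * mu = 0.
Proof.
have q0 : q != 0.
  apply: contra_eq_neq (cexp_mulN h1) => q0.
  by rewrite -hq q0 mul0r eq_sym oner_eq0.
have p0 : p != 0.
  apply: contra_eq_neq (cexp_mulN h2) => p0.
  by rewrite -hp p0 mul0r eq_sym oner_eq0.
(* Otherwise p and q would be mutually inverse exponentials. *)
have H0 : h1 + h2 != 0.
  apply: contra hpq1; rewrite addr_eq0 => /eqP h1E.
  by rewrite hp hq h1E cexp_mulN.
have hM' i j := congr1 (fun B : 'M[A]_2 => B i j) hM.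
have := hM' 0 0; have := hM' 0 1; have := hM' 1 0; have := hM' 1 1.
rewrite !mxE /= => -> -> -> ->.
have [XM YM XN YN] := lnmx_weights hA p0 q0 hT hqad hpda hlna hlnd hlnqd hlnpa
  hlnpqa hlnpqd hlnT.
have [MM NN] := lnmx_sqr hA p0 q0 hT hqad hpda hlna hlnd hlnqd hlnpa hlnT.
have MN := lnmx_anticomm hA p0 q0 hT hqad hpda hlna hlnd hlnqd hlnpa
  hlnpqa hlnpqd hlnT.
have XY := lnmx_comm_diag hA p0 q0 hpq1 hT hqad hpda hlna hlnd hlnqd hlnpa
  hlnpqa hlnpqd hlnT.
have ZZ (s t : A) : (h^-1 *: s) * (h^-1 *: t) = (h^-1 * h^-1) *: (s * t).
  by rewrite -scalerAl -scalerAr scalerA.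
(* Brackets scale by h^-2 and entries by h^-1; the remaining 1/h is 2/(h1 + h2). *)
have hk k : h^-1 * h^-1 * k = 2 * k / (h1 + h2) * h^-1.
  by rewrite hh; field.
rewrite !expr2 !ZZ -!scalerBr -scalerDr XM YM XN YN MM NN MN XY.
by rewrite !scaler0 !scalerA !hk.
Qed.
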